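(* Let $\mathcal A(M_T)$ be a positive GLP algebra of rank $n$ pointed at $t_0\in T$, and let $X_t,X_{t'}$ be any two clusters of $\mathcal A(M_T)$. Then: (i) each $x_{j;t'}$ ($1\le j\le n$) has the form $$x_{j;t'}=\mathbf x_t^{\mathbf r_{j;t}^{t'}}\Bigl(1+\sum_{0\ne\mathbf v\in\mathbb N^m,\ \mathbf u\in\mathbb Z^n}c_{\mathbf v,\mathbf u}\,\mathbf y^{\mathbf v}\mathbf x_t^{\mathbf u}\Bigr)\quad\text{(finite sum)},\qquad c_{\mathbf v,\mathbf u}\ge0,$$ for some $\mathbf r_{j;t}^{t'}\in\mathbb Z^n$ and integers $c_{\mathbf v,\mathbf u}$; (ii) $G_{t'}^{t_0}=G_t^{t_0}R_t^{t'}$, where $R_t^{t'}=(\mathbf r_{1;t}^{t'},\dots,\mathbf r_{n;t}^{t'})$ is the $n\times n$ matrix whose columns are the vectors $\mathbf r_{j;t}^{t'}$ of (i). In particular, $\det G_t^{t_0}=\pm1$.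
   Context: Let $\mathbb P$ be a (multiplicative) abelian group whose group ring $\mathbb{ZP}$ is a domain, and let $\mathcal F$ be the field of rational functions in $n$ independent variables with coefficients in $\mathbb{ZP}$. $\mathbb N$ denotes the nonnegative integers. A cluster in $\mathcal F$ is $X_t=\{x_{1;t},\dots,x_{n;t}\}$ such that $x_{1;t},\dots,x_{n;t}$ form a free generating set of $\mathcal F$ (over the fraction field of $\mathbb{ZP}$); its elements are called cluster variables. For an index set $T$, a family of clusters $M_T=\{X_t\mid t\in T\}$ in $\mathcal F$ is a GLP (generalized Laurent phenomenon) pattern of rank $n$ if $X_{t'}\subseteq\mathbb{ZP}[x_{1;t}^{\pm1},\dots,x_{n;t}^{\pm1}]$ for all $t,t'\in T$. The GLP algebra $\mathcal A(M_T)$ is the $\mathbb{ZP}$-subalgebra of $\mathcal F$ generated by all cluster variables of $M_T$. Let $m\ge 0$ and let $y_1,\dots,y_m\in\mathbb P$ be such that $x_{1;t},\dots,x_{n;t},y_1,\dots,y_m$ are algebraically independent over $\mathbb Z$. Put $\mathcal L_p(t)=\mathbb Z[y_1,\dots,y_m][x_{1;t}^{\pm1},\dots,x_{n;t}^{\pm1}]$ and $\mathcal L_p^+(t)=\mathbb Z_{\ge0}[y_1,\dots,y_m][x_{1;t}^{\pm1},\dots,x_{n;t}^{\pm1}]$. Write $\mathbf x_t^{\mathbf a}=\prod_{i=1}^n x_{i;t}^{a_i}$ for $\mathbf a\in\mathbb Z^n$ and $\mathbf y^{\mathbf v}=\prod_{i=1}^m y_i^{v_i}$ for $\mathbf v\in\mathbb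 N^m$. $\mathcal A(M_T)$ is of geometric type if $X_{t'}\subseteq\mathcal L_p(t)$ for all $t,t'\in T$. It is pointed at $t_0\in T$ if it is of geometric type and every cluster variable $x_{i;t}$ of $M_T$ has the form (finite sum) $$x_{i;t}=\mathbf x_{t_0}^{\mathbf g_{i;t}^{t_0}}\Bigl(1+\sum_{0\ne\mathbf v\in\mathbb N^m,\ \mathbf u\in\mathbb Z^n}c_{\mathbf v,\mathbf u}\,\mathbf y^{\mathbf v}\mathbf x_{t_0}^{\mathbf u}\Bigr),\qquad c_{\mathbf v,\mathbf u}\in\mathbb Z,$$ with $\mathbf g_{i;t}^{t_0}\in\mathbb Z^n$, called the $\mathbf g$-vector of $x_{i;t}$ with respect to $X_{t_0}$. The $G$-matrix of $X_t$ with respect to $X_{t_0}$ is $G_t^{t_0}=(\mathbf g_{1;t}^{t_0},\dots,\mathbf g_{n;t}^{t_0})\in M_n(\mathbb Z)$ (columns are $\mathbf g$-vectors). A GLP algebra pointed at $t_0$ is positive if $X_{t'}\subseteq\mathcal L_p^+(t)$ for all $t,t'\in T$. *)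

(* Defs.v *)
From HB Require Import structures.
From mathcomp Require Import all_boot all_order all_algebra.
From mathcomp Require Import finmap fraction.
From mathcomp Require monalg boolp.

Set Implicit Arguments.
Unset Strict Implicit.
Unset Printing Implicit Defensive.

Import GRing.Theory Num.Theory.

Local Open Scope ring_scope.

(* The abelian group P is a [zmodType], i.e. it is written additively; in the
   group ring the element p is the formal generator [gr_of p], and
   [gr_of (p + q) = gr_of p * gr_of q] ([gr_ofD]). *)

Module GroupRing.
Import monalg.
Local Open Scope fset_scope.

Section Ring.
Context (P : zmodType).

Definition group_ring : Type := {malg int[P]}.

HB.instance Definition _ := GRing.Zmodule.on group_ring.

Implicit Types (f g h : group_ring) (p q : P).

Definition gr_of p : group_ring := << p >>.

Definition gr_mul f g : group_ring :=
  \sum_(p <- msupp f) \sum_(q <- msupp g) << f@_p * g@_q *g (p + q)%R >>.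

Lemma gr_mulw (d1 d2 : {fset P}) f g :
  msupp f `<=` d1 -> msupp g `<=` d2 ->
  gr_mul f g = \sum_(p <- d1) \sum_(q <- d2) << f@_p * g@_q *g (p + q)%R >>.
Proof.
move=> le1 le2; rewrite /gr_mul (big_fset_incl _ le1) /=.
  apply/eq_bigr=> k1 _; apply/big_fset_incl => // k _ /mcoeff_outdom ->.
  by rewrite mulr0 monalgU0.
move=> k _ /mcoeff_outdom g1k.
by rewrite big1 => // k' _; rewrite g1k mul0r monalgU0.
Qed.

Lemma gr_mulC : commutative gr_mul.
Proof.
move=> f g; rewrite /gr_mul exchange_big; apply/eq_bigr => p _.
by apply/eq_bigr => q _; rewrite mulrC addrC.
Qed.

Lemma gr_mul0 : left_zero 0 gr_mul.
Proof. by move=> g; rewrite /gr_mul msupp0 big_seq_fset0. Qed.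

Lemma gr_mulUU (c1 c2 : int) p q :
  gr_mul << c1 *g p >> << c2 *g q >> = << c1 * c2 *g (p + q)%R >>.
Proof. by rewrite (gr_mulw msuppU_le msuppU_le) !big_seq_fset1 !mcoeffUU. Qed.

Lemma gr_mulUg (c : int) p g :
  gr_mul << c *g p >> g = \sum_(q <- msupp g) << c * g@_q *g (p + q)%R >>.
Proof.
rewrite (gr_mulw msuppU_le (fsubset_refl _)) big_seq_fset1.
by apply/eq_bigr => q _; rewrite mcoeffUU.
Qed.

Lemma gr_mulE1 f g :
  gr_mul f g = \sum_(p <- msupp f) gr_mul << f@_p *g p >> g.
Proof. by apply/eq_bigr=> p _; rewrite gr_mulUg. Qed.

Lemma gr_mul1 : left_id (gr_of 0) gr_mul.
Proof.
move=> g; rewrite gr_mulUg [RHS]monalgE.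
by apply/eq_bigr=> q _; rewrite mul1r add0r.
Qed.

Lemma gr_mulDl : left_distributive gr_mul +%R.
Proof.
move=> f g h.
have le1 := fsubsetUl (msupp f) (msupp g).
have le2 := fsubsetUr (msupp f) (msupp g).
rewrite (gr_mulw (msuppD_le f g) (fsubset_refl (msupp h))).
rewrite (gr_mulw le1 (fsubset_refl (msupp h))).
rewrite (gr_mulw le2 (fsubset_refl (msupp h))).
rewrite -big_split /=; apply/eq_bigr=> p _.
rewrite -big_split /=; apply/eq_bigr=> q _.
by rewrite mcoeffD mulrDl monalgUD.
Qed.

Lemma gr_mul_suml (I : Type) (r : seq I) (F : I -> group_ring) g :
  gr_mul (\sum_(i <- r) F i) g = \sum_(i <- r) gr_mul (F i) g.
Proof.
exact: (big_morph (gr_mul^~ _) (fun _ _ => gr_mulDl _ _ _) (gr_mul0 _)).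
Qed.

Lemma gr_mul_sumr (I : Type) (r : seq I) (F : I -> group_ring) g :
  gr_mul g (\sum_(i <- r) F i) = \sum_(i <- r) gr_mul g (F i).
Proof.
by rewrite gr_mulC gr_mul_suml; apply/eq_bigr => i _; rewrite gr_mulC.
Qed.

Lemma gr_mulA : associative gr_mul.
Proof.
move=> f g h; rewrite [LHS]gr_mulE1 [gr_mul f g]gr_mulE1 gr_mul_suml.
apply/eq_bigr => p _; rewrite [gr_mul g h]gr_mulE1 gr_mul_sumr.
rewrite [gr_mul _ g]gr_mulUg gr_mul_suml; apply/eq_bigr => q _.
rewrite [gr_mul _ h]gr_mulUg gr_mul_sumr [RHS]gr_mulUg.
by apply/eq_bigr => s _; rewrite gr_mulUU mulrA addrA.
Qed.

Lemma gr_one_neq0 : gr_of 0 != 0.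
Proof.
by apply/eqP => /(congr1 (@mcoeff P int 0)) /eqP; rewrite mcoeffUU mcoeff0.
Qed.

HB.instance Definition _ := GRing.Zmodule_isComNzRing.Build group_ring
  gr_mulA gr_mulC gr_mul1 gr_mulDl gr_one_neq0.

Lemma gr_ofD p q : gr_of (p + q) = gr_of p * gr_of q.
Proof. by rewrite [RHS]gr_mulUU mulr1. Qed.

(* The inverse of a group ring element is chosen classically; [idomainType]
   requires such an operation. *)
Definition gr_unit : pred group_ring :=
  fun f => boolp.asbool (exists g, g * f = 1).

Definition gr_inv f : group_ring :=
  if boolp.pselect (exists g, g * f = 1) is left e
  then projT1 (boolp.cid e) else f.

Lemma gr_mulVf : {in gr_unit, left_inverse 1 gr_inv *%R}.
Proof.
move=> f /boolp.asboolP uf; rewrite /gr_inv.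
by case: boolp.pselect => // e; case: boolp.cid.
Qed.

Lemma gr_unitP : forall f g, g * f = 1 -> gr_unit f.
Proof. by move=> f g gf; apply/boolp.asboolP; exists g. Qed.

Lemma gr_inv_out : {in [predC gr_unit], gr_inv =1 id}.
Proof.
move=> f /negP nuf; rewrite /gr_inv; case: boolp.pselect => // e.
by case: nuf; apply/boolp.asboolP.
Qed.

HB.instance Definition _ := GRing.ComNzRing_hasMulInverse.Build group_ring
  gr_mulVf gr_unitP gr_inv_out.

End Ring.
End GroupRing.

HB.export GroupRing.
Notation group_ring := GroupRing.group_ring.
Notation gr_of := GroupRing.gr_of.

From mathcomp Require Import mpoly.

Definition gr_domain (P : zmodType)
    (domP : GRing.integral_domain_axiom (group_ring P)) : idomainType :=
  HB.pack (group_ring P)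
    (GRing.ComUnitRing_isIntegral.Build (group_ring P) domP).

Lemma frac_repr (A : idomainType) (z : {fraction A}) :
  z = tofrac \n_(repr z) / tofrac \d_(repr z).
Proof.
have d0 : tofrac \d_(repr z) != 0 by rewrite tofrac_eq0 denom_ratioP.
apply: (mulIf d0); rewrite mulfVK //; set r := repr z.
have -> : z = \pi_({fraction A})%qT r by rewrite reprK.
unlock FracField.tofrac; rewrite -[LHS]FracField.pi_mul; apply/eqP.
rewrite eqmodE /= FracField.equivfE /FracField.mulf.
by rewrite !numden_Ratio ?mulf_neq0 ?oner_eq0 ?denom_ratioP // !mulr1 mulrC.
Qed.

Section RationalFunctions.
Context (A : idomainType) (n : nat).

Definition ratfun : fieldType := {fraction {mpoly A[n]}}.

Definition coef (a : A) : ratfun := tofrac (a%:MP_[n]).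

(* The embedding of Frac(A) into A(z_1, ..., z_n), computed on the
   representative of a fraction provided by the quotient {fraction A};
   [fcoefE] shows that the choice of the representative is irrelevant. *)
Definition fcoef (a : {fraction A}) : ratfun :=
  coef \n_(repr a) / coef \d_(repr a).

Lemma coef_eq0 (a : A) : (coef a == 0) = (a == 0).
Proof. by rewrite tofrac_eq0 mpolyC_eq0. Qed.

Lemma coefM (a b : A) : coef (a * b) = coef a * coef b.
Proof. by rewrite /coef mpolyCM tofracM. Qed.

Lemma fcoefE (a b : A) : b != 0 ->
  fcoef (tofrac a / tofrac b) = coef a / coef b.
Proof.
move=> b0; rewrite /fcoef; set r := repr _; have d0 := denom_ratioP r.
have /eqP : tofrac a / tofrac b = tofrac \n_r / tofrac \d_r by exact: frac_repr.
rewrite eqr_div ?tofrac_eq0 // -!tofracM tofrac_eq => /eqP rE.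
by apply/eqP; rewrite eqr_div ?coef_eq0 // -!coefM rE.
Qed.

End RationalFunctions.

(* [f] is the structure morphism from the base ring to [F]. *)
Definition algebraically_independent (A : nzRingType) (F : fieldType)
    (f : A -> F) (k : nat) (s : 'I_k -> F) : Prop :=
  forall p : {mpoly A[k]}, mmap f s p = 0 -> p = 0.

Definition generates (A : nzRingType) (F : fieldType)
    (f : A -> F) (k : nat) (s : 'I_k -> F) : Prop :=
  forall z : F, exists p q : {mpoly A[k]},
    mmap f s q != 0 /\ z = mmap f s p / mmap f s q.

(* Exponents of cluster variables are column vectors in Z^n, exponents of y are
   multinomials (elements of N^m); a finite sum over these exponents is given
   by its finitely supported coefficient function. *)
Section LaurentExpansions.
Context (F : fieldType) (n m : nat).
Implicit Types (x : 'I_n -> F) (y : 'I_m -> F).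

Definition yx_coeffs := {fsfun 'X_{1..m} * 'cV[int]_n -> int with 0}.

Definition xmon x (a : 'cV[int]_n) : F := \prod_(i < n) x i ^ a i 0.

Definition ymon y (v : 'X_{1..m}) : F := \prod_(i < m) y i ^+ v i.

Definition yx_sum y x (c : yx_coeffs) : F :=
  \sum_(k <- finsupp c) (c k)%:~R * ymon y k.1 * xmon x k.2.

(* z lies in Z[y_1, ..., y_m][x_1^{+-1}, ..., x_n^{+-1}] *)
Definition Lp y x (z : F) : Prop := exists c : yx_coeffs, z = yx_sum y x c.

Definition Lp_plus y x (z : F) : Prop :=
  exists c : yx_coeffs, (forall k, 0 <= c k) /\ z = yx_sum y x c.

Definition pointed_form y x (z : F) (g : 'cV[int]_n) : Prop :=
  exists c : yx_coeffs, (forall u, c (0%MM, u) = 0) /\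
            z = xmon x g * (1 + yx_sum y x c).

Definition positive_pointed_form y x (z : F) (r : 'cV[int]_n) : Prop :=
  exists c : yx_coeffs, [/\ forall u, c (0%MM, u) = 0,
                forall k, 0 <= c k &
                z = xmon x r * (1 + yx_sum y x c)].

End LaurentExpansions.

Section GLP.
Context (P : zmodType)
        (domP : GRing.integral_domain_axiom (group_ring P)) (n : nat).

Let ZP : idomainType := gr_domain domP.
Let FF : fieldType := ratfun ZP n.

Definition is_cluster (x : 'I_n -> FF) : Prop :=
  algebraically_independent (@fcoef ZP n) x /\ generates (@fcoef ZP n) x.

Definition laurent_ZP (x : 'I_n -> FF) (z : FF) : Prop :=
  exists c : {fsfun 'cV[int]_n -> ZP with 0},
    z = \sum_(u <- finsupp c) coef n (c u) * xmon x u.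

Definition GLP_pattern (T : Type) (X : T -> 'I_n -> FF) : Prop :=
  (forall t, is_cluster (X t)) /\
  (forall t t' i, laurent_ZP (X t) (X t' i)).

Section GeometricType.
Context (m : nat) (y : 'I_m -> P) (T : Type) (X : T -> 'I_n -> FF).

Definition yval (i : 'I_m) : FF := coef n (gr_of (y i) : ZP).

(* X_t together with y_1, ..., y_m is algebraically independent over Z. *)
Definition xy_independent (t : T) : Prop :=
  algebraically_independent (fun z : int => z%:~R : FF)
    (fun k : 'I_(n + m) =>
       match split k with inl i => X t i | inr j => yval j end).

Definition geometric_type : Prop :=
  forall t t' i, Lp yval (X t) (X t' i).

Definition is_G_matrix (t0 t : T) (G : 'M[int]_n) : Prop :=
  forall i, pointed_form yval (X t0) (X t i) (col i G).

Definition is_R_matrix (t t' : T) (R : 'M[int]_n) : Prop :=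
  forall j, positive_pointed_form yval (X t) (X t' j) (col j R).

Definition pointed_at (t0 : T) : Prop :=
  geometric_type /\
  forall t i, exists g, pointed_form yval (X t0) (X t i) g.

Definition positive : Prop :=
  forall t t' i, Lp_plus yval (X t) (X t' i).

End GeometricType.
End GLP.

(* Main.v *)
Require Import Defs.
From HB Require Import structures.
From mathcomp Require Import all_boot all_order all_algebra.
From mathcomp Require Import finmap fraction mpoly.
From mathcomp Require Import zify.

Set Implicit Arguments.
Unset Strict Implicit.
Unset Printing Implicit Defensive.

Import GRing.Theory Num.Theory.

Local Open Scope ring_scope.

(** The theorem holds because the passage to y = 0 turns pointed elements into
    Laurent monomials.  Write x for the cluster at t0.  Setting y = 0 in the
    pointed form of x_(i;t) leaves the monomial x^(g_i), so a Laurent monomial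
    x_t^u becomes x^(G u), and the expansion of x_(j;t') in the cluster at t
    with coefficients c_(v,u) >= 0 becomes

      x^(g'_j) = \sum_u c_(0,u) x^(G u).

    A sum of monomials with nonnegative integer coefficients is a monomial only
    if it has a single term, of coefficient 1.  This term x_t^r is the leading
    monomial in (i), and comparison of exponents gives g'_j = G r, which is (ii).
    At t' = t0 the matrix G' is the identity, so G is invertible over Z.

    Setting y = 0 in a negative power of x_(i;t) requires denominators, since
    x_(i;t) need not be invertible in the Laurent ring of x.  The relation
    [specializes] handles them: it is the graph of the extension of a ring
    morphism to the fractions whose denominator it does not kill, and algebraic
    independence of x and y makes it functional ([specializes_fun]).  Rather
    than keeping x generic, one also sends it to a point rho of Q^n with nonzero
    coordinates ([spec_at_pointed]); two kinds of points suffice.  At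
    rho = (1, ..., 1) the identity above says that the integers c_(0,u) have
    sum 1, which singles out the leading term ([positive_pointed_of_Lp_plus]).
    At rho = (1, ..., 2, ..., 1), with 2 in position i, it compares the i-th
    exponents ([xmon_inj]). *)

(** * Specialization of fractions along a ring morphism *)

Section Specialization.
Context (A : comNzRingType) (F K : fieldType).
Context (ev : {rmorphism A -> F}) (sg : {rmorphism A -> K}).
Hypothesis ev_inj : injective ev.

(** The formula for a makes sense without extending [sg] to a localization of
    [A], and its independence of p and q follows from the injectivity of [ev]. *)
Definition specializes (z : F) (a : K) : Prop :=
  exists p q, [/\ sg q != 0, z = ev p / ev q & a = sg p / sg q].

Lemma ev_neq0 q : sg q != 0 -> ev q != 0.
Proof.
by apply: contra_neq => ev0; rewrite (ev_inj (etrans ev0 (esym (rmorph0 ev)))) rmorph0.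
Qed.

Lemma specializes_fun z a b : specializes z a -> specializes z b -> a = b.
Proof.
move=> [p [q [q0 -> ->]]] [p' [q' [q'0 /eqP + ->]]].
rewrite eqr_div ?ev_neq0 // -!rmorphM => /eqP /ev_inj pq.
by apply/eqP; rewrite eqr_div // -!rmorphM pq.
Qed.

Lemma specializes_ev p : specializes (ev p) (sg p).
Proof. by exists p, 1; rewrite !rmorph1 !divr1 oner_neq0. Qed.

Lemma specializes_int (k : int) : specializes k%:~R k%:~R.
Proof. by rewrite -(rmorph_int ev) -(rmorph_int sg); exact: specializes_ev. Qed.

Lemma specializesD z w a b :
  specializes z a -> specializes w b -> specializes (z + w) (a + b).
Proof.
move=> [p [q [q0 -> ->]]] [p' [q' [q'0 -> ->]]].
exists (p * q' + p' * q), (q * q').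
by rewrite !addf_div ?ev_neq0 // !(rmorphM, rmorphD) mulf_neq0.
Qed.

Lemma specializesM z w a b :
  specializes z a -> specializes w b -> specializes (z * w) (a * b).
Proof.
move=> [p [q [q0 -> ->]]] [p' [q' [q'0 -> ->]]].
by exists (p * p'), (q * q'); rewrite !mulf_div !rmorphM mulf_neq0.
Qed.

Lemma specializesV z a : a != 0 -> specializes z a -> specializes z^-1 a^-1.
Proof.
move=> a0 [p [q [q0 -> aE]]]; exists q, p; rewrite aE !invf_div; split=> //.
by apply: contra_neq a0 => p0; rewrite aE p0 mul0r.
Qed.

Lemma specializes_neq0 z a : a != 0 -> specializes z a -> z != 0.
Proof.
move=> + za; apply: contra_neq => z0; apply: (specializes_fun za).
by rewrite z0; exact: (specializes_int 0).
Qed.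

Lemma specializes_prod (I : Type) (s : seq I) (z : I -> F) (a : I -> K) :
  (forall i, specializes (z i) (a i)) ->
  specializes (\prod_(i <- s) z i) (\prod_(i <- s) a i).
Proof.
move=> za; elim: s => [|i s IH]; first by rewrite !big_nil; exact: (specializes_int 1).
by rewrite !big_cons; exact: specializesM.
Qed.

Lemma specializes_sum (I : Type) (s : seq I) (z : I -> F) (a : I -> K) :
  (forall i, specializes (z i) (a i)) ->
  specializes (\sum_(i <- s) z i) (\sum_(i <- s) a i).
Proof.
move=> za; elim: s => [|i s IH]; first by rewrite !big_nil; exact: (specializes_int 0).
by rewrite !big_cons; exact: specializesD.
Qed.

Lemma specializesX z a k : specializes z a -> specializes (z ^+ k) (a ^+ k).
Proof.
move=> za; elim: k => [|k IH]; first exact: (specializes_int 1).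
by rewrite !exprS; exact: specializesM.
Qed.

Lemma specializesXz z a (k : int) :
  a != 0 -> specializes z a -> specializes (z ^ k) (a ^ k).
Proof.
move=> a0 za; case: k => k; first exact: specializesX.
by apply: specializesV; [exact: expf_neq0 | exact: specializesX].
Qed.

Lemma specializes_xmon n (x : 'I_n -> F) (a : 'I_n -> K) u :
  (forall i, a i != 0) -> (forall i, specializes (x i) (a i)) ->
  specializes (xmon x u) (xmon a u).
Proof. by move=> a0 xa; apply: specializes_prod => i; exact: specializesXz. Qed.

Section VanishingY.
Context (m : nat) (y : 'I_m -> F).
Hypothesis y_spec0 : forall j, specializes (y j) 0.

Lemma specializes_ymon v : specializes (ymon y v) (v == 0%MM)%:R.
Proof.
suff <- : \prod_(j < m) (0 : K) ^+ v j = (v == 0%MM)%:R.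
  by apply: specializes_prod => j; exact: specializesX.
have [->|v0] := eqVneq v 0%MM; first by rewrite big1 // => j _; rewrite mnm0E.
have [j vj] : exists j, v j != 0%N.
  apply/existsP; apply: contraNT v0; rewrite negb_exists => /forallP v0.
  by apply/eqP/mnmP => j; rewrite mnm0E; apply/eqP; rewrite -[_ == _]negbK.
by rewrite (bigD1 j) //= expr0n (negbTE vj) mul0r.
Qed.

Lemma specializes_yx_sum n (x : 'I_n -> F) (a : 'I_n -> K) (c : yx_coeffs n m) :
  (forall i, a i != 0) -> (forall i, specializes (x i) (a i)) ->
  specializes (yx_sum y x c)
    (\sum_(k <- finsupp c | k.1 == 0%MM) (c k)%:~R * xmon a k.2).
Proof.
move=> a0 xa; rewrite big_mkcond.
apply: specializes_sum => k.
have -> : (if k.1 == 0%MM then (c k)%:~R * xmon a k.2 else 0)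
          = (c k)%:~R * (k.1 == 0%MM)%:R * xmon a k.2.
  by case: eqP => _; rewrite ?mulr1 // mulr0 mul0r.
apply: specializesM; last exact: specializes_xmon.
by apply: specializesM; [exact: specializes_int | exact: specializes_ymon].
Qed.

(** The leading monomial is all that survives at y = 0. *)
Lemma specializes_pointed n (x : 'I_n -> F) (a : 'I_n -> K) z g :
  (forall i, a i != 0) -> (forall i, specializes (x i) (a i)) ->
  pointed_form y x z g -> specializes z (xmon a g).
Proof.
move=> a0 xa [c [c0 ->]]; rewrite -[xmon a g]mulr1.
apply: specializesM; first exact: specializes_xmon.
rewrite -[X in specializes _ X]addr0; apply: specializesD.
  exact: (specializes_int 1).
have := specializes_yx_sum c a0 xa.
by rewrite big1 // => -[v u] /= /eqP ->; rewrite c0 mul0r.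
Qed.

End VanishingY.
End Specialization.

(** * Laurent monomials *)

Section Monomials.
Context (F : fieldType) (n : nat).
Implicit Types (x : 'I_n -> F) (u : 'cV[int]_n).

Lemma xmon_neq0 x u : (forall i, x i != 0) -> xmon x u != 0.
Proof. by move=> x0; apply/prodf_neq0 => i _; rewrite expfz_neq0. Qed.

Lemma xmonD x u v : (forall i, x i != 0) -> xmon x (u + v) = xmon x u * xmon x v.
Proof.
by move=> x0; rewrite -big_split; apply: eq_bigr => i _; rewrite mxE expfzDr.
Qed.

Lemma xmon_sum x (I : Type) (s : seq I) (u : I -> 'cV[int]_n) :
  (forall i, x i != 0) -> xmon x (\sum_(i <- s) u i) = \prod_(i <- s) xmon x (u i).
Proof.
move=> x0; apply: (big_morph (xmon x)) => [u1 u2|]; first exact: xmonD.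
by apply: big1 => i _; rewrite mxE.
Qed.

Lemma xmon_delta x i : xmon x (delta_mx i 0) = x i.
Proof.
rewrite /xmon (bigD1 i) //= mxE !eqxx big1 ?mulr1 // => j ji.
by rewrite mxE (negbTE ji).
Qed.

Lemma xmon1 u : xmon (fun=> 1 : F) u = 1.
Proof. by apply: big1 => i _; rewrite exp1rz. Qed.

Lemma xmonZ x (k : int) u : xmon x (k *: u) = xmon x u ^ k.
Proof.
rewrite /xmon; apply: (big_rec2 (fun a b => a = b ^ k)) => [|i a b _ ->].
  by rewrite exp1rz.
by rewrite expfzMl exprz_exp mxE [k * _]mulrC.
Qed.

Lemma xmon_mulmx x (G : 'M[int]_n) u : (forall i, x i != 0) ->
  xmon (fun i => xmon x (col i G)) u = xmon x (G *m u).
Proof.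
move=> x0.
have -> : G *m u = \sum_(i < n) u i 0 *: col i G.
  apply/colP => j; rewrite summxE !mxE; apply: eq_bigr => i _.
  by rewrite !mxE mulrC.
by rewrite xmon_sum //; apply: eq_bigr => i _; rewrite xmonZ.
Qed.

End Monomials.

(** Points of Q^n separate exponents: at the point with value 2 in position i
    and 1 elsewhere, the monomial of exponent u takes the value 2^(u_i). *)
Lemma xmon_inj n (u v : 'cV[int]_n) :
  (forall rho : 'I_n -> rat, (forall i, rho i != 0) -> xmon rho u = xmon rho v) ->
  u = v.
Proof.
move=> uv; apply/colP => i.
pose rho j : rat := if j == i then 2 else 1.
have rhoE w : xmon rho w = 2 ^ w i 0.
  rewrite /xmon (bigD1 i) //= /rho eqxx big1 ?mulr1 // => j /negbTE ->.
  by rewrite exp1rz.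
have rho0 j : rho j != 0 by rewrite /rho; case: ifP.
by have := uv rho rho0; rewrite !rhoE; exact: ieexprIz.
Qed.

(** * Extraction of the leading monomial *)

Lemma sum_eq1_nonneg (I : eqType) (s : seq I) (c : I -> int) :
  uniq s -> (forall i, 0 <= c i) -> \sum_(i <- s) c i = 1 ->
  exists2 i, i \in s & c i = 1 /\ forall j, j \in s -> j != i -> c j = 0.
Proof.
move=> us c0 cs1.
have [i is_ ci] : exists2 i, i \in s & c i != 0.
  apply/hasP; apply/negPn; apply/negP => /hasPn cs0; move: cs1.
  by rewrite big1_seq // => i /cs0 /negPn /eqP.
move: cs1; rewrite (bigD1_seq i) //=; set S := \sum_(_ <- _ | _) _ => cs1.
have S0 : 0 <= S by apply: sumr_ge0.
have ci1 : c i = 1.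
  by move: (c0 i) ci S0 cs1; clear; lia.
exists i => //; split=> // j js ji.
have : S = 0 by move: cs1; rewrite ci1 -[RHS]addr0 => /addrI.
move/eqP; rewrite psumr_eq0 // => /allP /(_ j js).
by rewrite ji => /eqP.
Qed.

Section LeadingMonomial.
Context (F : fieldType) (n m : nat) (y : 'I_m -> F) (x : 'I_n -> F).

(** The hypothesis on the sum leaves a single exponent (0, r) with v = 0, of
    coefficient 1; factoring out x^r shifts the exponents of x by -r. *)
Lemma positive_pointed_of_sum1 (c : yx_coeffs n m) :
  (forall i, x i != 0) -> (forall k, 0 <= c k) ->
  \sum_(k <- finsupp c | k.1 == 0%MM) c k = 1 ->
  exists r, positive_pointed_form y x (yx_sum y x c) r.
Proof.
move=> x0 c0; rewrite -big_filter => /sum_eq1_nonneg.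
case=> [||[v r] /=]; rewrite ?filter_uniq ?fset_uniq //.
rewrite mem_filter /= => /andP[/eqP -> {v} rc] [cr1 cE].
pose D : {fset 'X_{1..m} * 'cV[int]_n} :=
  [fset (k.1, k.2 - r) | k in (finsupp c `\ (0%MM, r))%fset]%fset.
pose d : yx_coeffs n m := [fsfun k in D => c (k.1, k.2 + r)].
have dE k : k \in D -> d k = c (k.1, k.2 + r) by move=> kD; rewrite fsfunE kD.
exists r, d; split.
- move=> u; rewrite fsfunE /D; case: ifP => //= /imfsetP[[v w] /= + [v0 uE]].
  rewrite !inE -v0 uE subrK => /andP[wr wc]; apply: cE => //.
  by rewrite mem_filter eqxx.
- by move=> k; rewrite fsfunE; case: ifP.
rewrite mulrDr mulr1 /yx_sum (big_fsetD1 (0%MM, r)) //= cr1 mul1r.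
congr (_ + _).
  by rewrite [X in X * _]big1 ?mul1r // => i _; rewrite mnm0E.
rewrite (big_fset_incl _ (finsupp_sub _ _ _)) => [|k _]; last first.
  by rewrite memNfinsupp => /eqP ->; rewrite !mul0r.
rewrite [X in _ = _ * X]big_imfset => [|[v u] [v' u'] _ _ /= [-> /addIr ->] //] /=.
rewrite mulr_sumr !big_seq; apply: eq_bigr => -[v u] vu /=.
rewrite dE /=; last by apply/imfsetP; exists (v, u).
by rewrite subrK mulrCA -xmonD // [r + _]addrC subrK.
Qed.

End LeadingMonomial.

(** * Specialization at y = 0 *)

Section AtPoint.
Context (n m : nat).

Definition eval_xy (K : fieldType) (x : 'I_n -> K) (y : 'I_m -> K) :
    {mpoly int[n + m]} -> K :=
  mmap intr (fun k => match split k with inl i => x i | inr j => y j end).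

HB.instance Definition _ K x y := GRing.RMorphism.on (@eval_xy K x y).

Lemma eval_xyX (K : fieldType) (x : 'I_n -> K) (y : 'I_m -> K) k :
  eval_xy x y 'X_k = match split k with inl i => x i | inr j => y j end.
Proof. by rewrite /eval_xy mmapX mmap1U. Qed.

Context (F : fieldType) (x : 'I_n -> F) (y : 'I_m -> F).
Hypothesis xy_indep : injective (eval_xy x y).
Implicit Types (rho : 'I_n -> rat) (z : F).

Definition spec_at rho : F -> rat -> Prop :=
  specializes (eval_xy x y) (eval_xy rho (fun=> 0)).

Lemma spec_at_x rho i : spec_at rho (x i) (rho i).
Proof.
have := specializes_ev (eval_xy x y) (eval_xy rho (fun=> 0)) 'X_(lshift m i).
by rewrite /= !eval_xyX (unsplitK (inl i)).
Qed.

Lemma spec_at_y rho j : spec_at rho (y j) 0.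
Proof.
have := specializes_ev (eval_xy x y) (eval_xy rho (fun=> 0)) 'X_(rshift n j).
by rewrite /= !eval_xyX (unsplitK (inr j)).
Qed.

Lemma spec_at_pointed rho z g : (forall i, rho i != 0) ->
  pointed_form y x z g -> spec_at rho z (xmon rho g).
Proof.
move=> rho0; apply: specializes_pointed => // i.
  exact: spec_at_y.
exact: spec_at_x.
Qed.

Section Cluster.
Context (x' : 'I_n -> F) (G : 'M[int]_n).
Hypothesis x'_pointed : forall i, pointed_form y x (x' i) (col i G).

Let point rho i := xmon rho (col i G).

Lemma spec_at_cluster rho i : (forall i, rho i != 0) ->
  spec_at rho (x' i) (point rho i).
Proof. by move=> rho0; exact: spec_at_pointed. Qed.

Lemma cluster_neq0 i : x' i != 0.
Proof.
have one0 (j : 'I_n) : (1 : rat) != 0 by exact: oner_neq0.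
apply: (specializes_neq0 xy_indep _ (spec_at_cluster (rho := fun=> 1) i one0)).
exact: xmon_neq0.
Qed.

(** At rho = (1, ..., 1) all Laurent monomials take the value 1, so that a
    pointed element specializes both to 1 and to the sum of the c_(0,u). *)
Lemma positive_pointed_of_Lp_plus z g :
  pointed_form y x z g -> Lp_plus y x' z ->
  exists r, positive_pointed_form y x' z r.
Proof.
move=> zg [c [c0 zE]]; rewrite zE; apply: positive_pointed_of_sum1 => //.
  exact: cluster_neq0.
pose one (i : 'I_n) : rat := 1.
have one0 i : one i != 0 by exact: oner_neq0.
have x'1 i : spec_at one (x' i) 1.
  by rewrite -(xmon1 rat (col i G)); exact: spec_at_cluster.
have := specializes_yx_sum xy_indep (spec_at_y one) c one0 x'1.
rewrite -zE => /(specializes_fun xy_indep (spec_at_pointed one0 zg)).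
rewrite xmon1 => c1; apply: (@intr_inj rat); rewrite rmorph_sum /= [RHS]c1.
by apply: eq_bigr => k _; rewrite xmon1 mulr1.
Qed.

(** Since x'_i specializes to rho^(G_i), the leading monomial x'^r of z
    specializes to rho^(G r), for every rho. *)
Lemma g_vector_change z g r :
  pointed_form y x z g -> pointed_form y x' z r -> g = G *m r.
Proof.
move=> zg zr; apply: xmon_inj => rho rho0.
have point0 i : point rho i != 0 by exact: xmon_neq0.
rewrite -xmon_mulmx //.
apply: (specializes_fun xy_indep (spec_at_pointed rho0 zg)).
apply: (specializes_pointed _ (spec_at_y rho) _ _ zr) => // i.
exact: spec_at_cluster.
Qed.

End Cluster.
End AtPoint.

(** * Change of cluster *)

(** The G-matrix of the cluster at t0 is the identity, which makes the other
    G-matrices invertible. *)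
Lemma pointed_form_self (F : fieldType) n m (y : 'I_m -> F) (x : 'I_n -> F) i :
  pointed_form y x (x i) (delta_mx i 0).
Proof.
exists [fsfun]; split=> [u|]; first by rewrite fsfunE.
by rewrite /yx_sum finsupp0 big_seq_fset0 addr0 mulr1 xmon_delta.
Qed.

Lemma exists_matrix_cols n (Q : 'I_n -> 'cV[int]_n -> Prop) :
  (forall j, exists v, Q j v) -> exists M : 'M[int]_n, forall j, Q j (col j M).
Proof.
move=> /fin_all_exists[v vP]; exists (\matrix_(i, j) v j i 0) => j.
suff -> : col j (\matrix_(i, j) v j i 0) = v j by [].
by apply/colP => i; rewrite !mxE.
Qed.

Theorem theorem5p4 (P : zmodType)
    (domP : GRing.integral_domain_axiom (group_ring P)) (n m : nat)
    (y : 'I_m -> P) (T : Type)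
    (X : T -> 'I_n -> ratfun (gr_domain domP) n) (t0 : T)
    (hGLP : GLP_pattern X)
    (hindep : forall t, xy_independent y X t)
    (hpointed : pointed_at y X t0)
    (hpositive : positive y X)
    (t t' : T) :
  [/\ (forall j, exists r : 'cV[int]_n,
         positive_pointed_form (yval domP n y) (X t) (X t' j) r),
      (forall G G' R : 'M[int]_n,
         is_G_matrix y X t0 t G -> is_G_matrix y X t0 t' G' ->
         is_R_matrix y X t t' R -> G' = G *m R)
    & (forall G : 'M[int]_n,
         is_G_matrix y X t0 t G -> \det G = 1 \/ \det G = -1)].
Proof.
have indep : injective (eval_xy (X t0) (yval domP n y)).
  apply: raddf_inj; exact: hindep.
have [Gt GtP] : exists G, is_G_matrix y X t0 t G.
  exact: exists_matrix_cols (hpointed.2 t).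
have R_exists s j : exists r, positive_pointed_form (yval domP n y) (X t) (X s j) r.
  have [g gP] := hpointed.2 s j.
  exact: (positive_pointed_of_Lp_plus indep GtP gP (hpositive t s j)).
have GR s G G' R : is_G_matrix y X t0 t G -> is_G_matrix y X t0 s G' ->
    is_R_matrix y X t s R -> G' = G *m R.
  move=> GP G'P RP; apply/matrixP => i j.
  have [c [c0 _ zE]] := RP j.
  have /colP/(_ i) := g_vector_change indep GP (G'P j) (ex_intro _ c (conj c0 zE)).
  by rewrite !mxE => ->; apply: eq_bigr => k _; rewrite mxE.
split=> [||G GP]; [exact: R_exists | exact: GR |].
have [R RP] : exists R, is_R_matrix y X t t0 R.
  exact: exists_matrix_cols (R_exists t0).
have G1 : is_G_matrix y X t0 t0 1%:M.
  by move=> i; rewrite col1; exact: pointed_form_self.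
have /(congr1 determinant) := GR _ _ _ _ GP G1 RP.
by rewrite det1 det_mulmx mulrC => /esym /intUnitRing.unitzPl /orP[] /eqP ->;
  [left | right].
Qed.
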